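(* Let $\mu$ be an invariant probability measure of the Markov chain $X$ and let $X$ be mixing with respect to $\mathbb P_\mu$. Fix $x\in E$ and assume that there exists a set $M\in\mathcal E$ such that $\mu(M)>0$ and for every $y\in M$ there exists some $\xi_{x,y}\in\widehat C(\mathbb P_x,\mathbb P_y)$ such that $\pi_1(\xi_{x,y})\sim\mathbb P_x$ and $$\lim_{n\to\infty}\xi_{x,y}\big(d(X_n,Y_n)\le\varepsilon\big)=1\quad\text{for every }\varepsilon>0.$$ Then $P_n(x,\cdot)$ converges weakly to $\mu$ with respect to $d$ as $n\to\infty$.
   Context: Setting. $(E,\rho)$ is a Polish space ($\rho$ a complete separable metric, $\rho\le 1$) with Borel $\sigma$-algebra $\mathcal E$. $X=\{X_n,n\in\mathbb Z_+\}$ is a Markov chain with state space $(E,\mathcal E)$, transition kernel $P(x,dy)$ and $n$-step transition probabilities $P_n(x,dy)$; $\mathbb P_\mu$ is the law of $X$ on $E^\infty:=E^{\mathbb Z_+}$ when $X_0$ has law $\mu$, and $\mathbb P_x:=\mathbb P_{\delta_x}$. $\mu$ is invariant if $\mu(dy)=\int_E P(x,dy)\mu(dx)$. $X$ is mixing with respect to $\mathbb P_\mu$ if for all bounded measurable $f,g:E\to\mathbb R$, $\mathbb E_\mu[f(X_0)g(X_n)]\to\mathbb E_\mu f(X_0)\,\mathbb E_\mu g(X_0)$ as $n\to\infty$. $d$ is a second metric on $E$, bounded and continuous with respect to $\rho$ (possibly $d=\rho$), not assumed complete. $\overline E^d$ is the completion of $E$ with respect to $d$, and it is assumed that for every $y\in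 E$ there are $d$-continuous functions $\rho^y_n:\overline E^d\to[0,\infty)$, $n\ge1$, with $\rho_n^y(x)\to\rho(x,y)$ for $x\in E$ and $\rho_n^y(x)\to\infty$ for $x\in\overline E^d\setminus E$. Measurability refers to $\rho$. Weak convergence with respect to $d$ means convergence of integrals of all bounded $d$-continuous functions on $E$. For probability measures $\mathbb P,\mathbb Q$ on $E^\infty$, $\widehat C(\mathbb P,\mathbb Q)$ is the set of probability measures $\xi$ on $E^\infty\times E^\infty$ whose marginals satisfy $\pi_1(\xi)\ll\mathbb P$ and $\pi_2(\xi)\ll\mathbb Q$; $\sim$ means mutual absolute continuity. Under $\xi$, $(X_n)$ and $(Y_n)$ denote the first and second coordinate sequences on $E^\infty\times E^\infty$. *)

(* Defs.v *)
From HB Require Import structures.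
From mathcomp Require Import all_boot all_order all_algebra.
From mathcomp Require Import all_classical all_reals all_analysis.

Set Implicit Arguments.
Unset Strict Implicit.
Unset Printing Implicit Defensive.

Import Order.TTheory GRing.Theory Num.Theory.
Import numFieldNormedType.Exports.

Local Open Scope classical_set_scope.
Local Open Scope ring_scope.

#[short(type="completeMetricType")]
HB.structure Definition CompleteMetric (R : realType) :=
  { T of Metric R T & CompletePseudoMetric R T }.

Definition separable (T : topologicalType) : Prop :=
  exists2 D : set T, countable D & dense D.

(* A metric on [T] given as data, so that a type may carry a metric besides
   the one of its [metricType] structure. *)
Record metric_on (R : realType) (T : Type) := MetricOn {
  dist :> T -> T -> R ;
  distxx : forall x, dist x x = 0 ;
  dist_eq0 : forall x y, dist x y = 0 -> x = y ;
  dist_sym : forall x y, dist x y = dist y x ;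
  dist_triangle : forall y x z, dist x z <= dist x y + dist y z }.

(* The carrier of [d], with the metric structure and topology of [d]. *)
Definition mspace (R : realType) (T : choiceType) (d : metric_on R T) : Type :=
  T.

Section mspace_metric.
Context (R : realType) (T : choiceType) (d : metric_on R T).
HB.instance Definition _ := Choice.on (mspace d).
HB.instance Definition _ := @isMetric.Build R (mspace d)
  (dist d) (distxx d) (@dist_eq0 _ _ d) (dist_sym d) (@dist_triangle _ _ d).
End mspace_metric.

Definition is_completion (R : realType) (S : metricType R)
    (S' : completeMetricType R) (iota : S -> S') : Prop :=
  (forall x y, mdist (iota x) (iota y) = mdist x y) /\ dense (range iota).

Notation borel E := (g_sigma_algebraType (@open E)).

Definition coordinate_sets d (T : measurableType d) : set (set (nat -> T)) :=
  \bigcup_n preimage_set_system setT (fun w => w n) measurable.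

(* T^{Z_+} with its product sigma-algebra *)
Notation trajectory T := (g_sigma_algebraType (@coordinate_sets _ T)).

Section markov_chains.
Local Open Scope ereal_scope.
Context d (T : measurableType d) (R : realType).
Implicit Types (P : R.-pker T ~> T) (mu : probability T R).

Fixpoint nstep P (n : nat) : R.-spker T ~> T :=
  if n is m.+1 then mkcomp_noparam P (nstep P m)
  else kdirac (@measurable_id _ T setT).

(* \int_(A 0) P(x, dy_0) \int_(A 1) P(y_0, dy_1) ... , with n integrals *)
Fixpoint iterated_kernel P (n : nat) (A : nat -> set T) (x : T) : \bar R :=
  if n is m.+1
  then \int[P x]_(y in A 0%N) iterated_kernel P m (fun i => A i.+1) y
  else 1.

(* [Q] is the law on T^{Z_+} of the Markov chain with transition kernel [P] and
   initial law [mu]: such a [Q] exists (Ionescu-Tulcea) and is determined on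
   measurable sets by its finite-dimensional distributions. *)
Definition is_chain_law P mu (Q : probability (trajectory T) R) : Prop :=
  forall (n : nat) (A : nat -> set T), (forall i, measurable (A i)) ->
  Q [set w | forall i, (i <= n)%N -> A i (w i)] =
  \int[mu]_(x in A 0%N) iterated_kernel P n (fun i => A i.+1) x.

Definition invariant_measure P mu : Prop :=
  forall A, measurable A -> mu A = \int[mu]_x P x A.

Definition mixing (Q : probability (trajectory T) R) : Prop :=
  forall f g : T -> R,
    measurable_fun setT f -> bounded_fun f ->
    measurable_fun setT g -> bounded_fun g ->
  'E_Q[fun w => f (w 0%N) * g (w n)]%R @[n --> \oo]
    --> 'E_Q[fun w => f (w 0%N)] * 'E_Q[fun w => g (w 0%N)].

Definition mutually_ac d' (S : measurableType d') (m1 m2 : set S -> \bar R) :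
    Prop :=
  m1 `<< m2 /\ m2 `<< m1.

(* \widehat C(P1, P2): absolute continuity replaces equality of marginals. *)
Definition generalized_coupling d' (S : measurableType d')
    (P1 P2 : probability S R) : set (probability (S * S)%type R) :=
  [set xi | pushforward xi fst `<< P1 /\ pushforward xi snd `<< P2].

End markov_chains.

Definition weakly_converges (R : realType) (E : completeMetricType R)
    (d : metric_on R E) (m : nat -> {measure set (borel E) -> \bar R})
    (mu : {measure set (borel E) -> \bar R}) : Prop :=
  forall f : mspace d -> R, continuous f -> bounded_fun f ->
  (\int[m n]_y (f y)%:E)%E @[n --> \oo] --> (\int[mu]_y (f y)%:E)%E.

(* Main.v *)
(* No measurable selection of the couplings is needed. If
   E_x f(X_n) <= mu(f) - e for infinitely many n, with f bounded and
   d-Lipschitz, then mixing lets one pick such times n_0 < n_1 < ... so sparse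
   that the variables f(X_(n_k)) - mu(f) are almost orthogonal in L2(P_mu); hence
   their averages tend to 0 in L2(P_mu), and P_mu-a.s. along a subsequence of
   averages. As P_mu is the mixture of the P_y, this holds P_y-a.s. for some y in
   M, so almost surely for the second coordinate under xi_(x,y). By Lipschitz
   continuity and Cesaro the averages along the two coordinates differ by a
   quantity tending to 0 in L1(xi), so along a further subsequence the averages of
   the first coordinate tend to 0 almost surely under xi, hence under
   P_x << pi_1(xi), which contradicts the choice of the n_k. A bounded d-continuous
   f is the increasing limit of the Lipschitz functions
   inf_y (f y + k d(., y)), so the lower bound for Lipschitz functions, applied to
   f and to -f, gives weak convergence. *)

Require Import Defs.
From HB Require Import structures.
From mathcomp Require Import all_boot all_order all_algebra.
From mathcomp Require Import all_classical all_reals all_analysis.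
From mathcomp Require Import measurable_realfun.
From mathcomp Require Import ring lra.

Set Implicit Arguments.
Unset Strict Implicit.
Unset Printing Implicit Defensive.

Import Order.TTheory GRing.Theory Num.Theory.
Import numFieldNormedType.Exports.

Local Open Scope classical_set_scope.
Local Open Scope ring_scope.

(** * Bounded measurable functions and averages *)

(** This class is closed under the algebra used below and consists of integrable functions for every
    finite measure, so that linearity of integrals needs no separate integrability argument. *)
Definition bounded_measurable d (T : measurableType d) (R : realType)
    (F : T -> R) : Prop :=
  measurable_fun setT F /\ exists C, forall x, `|F x| <= C.

Section bounded_measurable_theory.
Context d (T : measurableType d) (R : realType).
Implicit Types F G : T -> R.

Lemma bounded_measurable_cst (c : R) : bounded_measurable (fun _ : T => c).
Proof. by split; [exact: measurable_cst|exists `|c|]. Qed.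

Lemma bounded_measurableD F G : bounded_measurable F -> bounded_measurable G ->
  bounded_measurable (fun x => F x + G x).
Proof.
move=> [mF [C FC]] [mG [D GD]]; split; first exact: measurable_funD.
by exists (C + D) => x; rewrite (le_trans (ler_normD _ _))// lerD.
Qed.

Lemma bounded_measurableM F G : bounded_measurable F -> bounded_measurable G ->
  bounded_measurable (fun x => F x * G x).
Proof.
move=> [mF [C FC]] [mG [D GD]]; split; first exact: measurable_funM.
by exists (C * D) => x; rewrite normrM ler_pM.
Qed.

Lemma bounded_measurableN F : bounded_measurable F ->
  bounded_measurable (fun x => - F x).
Proof.
move=> [mF [C FC]]; split; first exact: measurableT_comp.
by exists C => x; rewrite normrN.
Qed.

Lemma bounded_measurable_norm F : bounded_measurable F ->
  bounded_measurable (fun x => `|F x|).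
Proof.
move=> [mF [C FC]]; split; first exact: measurableT_comp.
by exists C => x; rewrite normr_id.
Qed.

Lemma bounded_measurable_sum (F : nat -> T -> R) n :
  (forall k, bounded_measurable (F k)) ->
  bounded_measurable (fun x => \sum_(0 <= k < n) F k x).
Proof.
move=> bF; elim: n => [|n IH].
  by under eq_fun do rewrite big_geq//; exact: bounded_measurable_cst.
under eq_fun do rewrite big_nat_recr//=.
exact: bounded_measurableD.
Qed.

Lemma bounded_measurable_comp d' (S : measurableType d') (h : S -> T) F :
  measurable_fun setT h -> bounded_measurable F ->
  bounded_measurable (fun x => F (h x)).
Proof.
move=> mh [mF [C FC]]; split; first exact: measurableT_comp.
by exists C.
Qed.

Lemma bounded_measurable_integrable (m : {finite_measure set T -> \bar R}) F :
  bounded_measurable F -> m.-integrable setT (EFin \o F).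
Proof.
move=> [mF [C FC]].
apply: (@le_integrable _ _ _ m _ _ _ (EFin \o cst C)) => //.
- exact/measurable_EFinP.
- move=> x _ /=; rewrite lee_fin (le_trans (FC x))// ler_norm//.
- exact: finite_measure_integrable_cst.
Qed.

Lemma Rintegral_probability_cst (Q : probability T R) (c : R) :
  \int[Q]_x c = c.
Proof. by rewrite Rintegral_cst//= probability_setT mulr1. Qed.

Lemma EFin_Rintegral (m : {finite_measure set T -> \bar R}) F :
  bounded_measurable F -> (\int[m]_x F x)%:E = (\int[m]_x (F x)%:E)%E.
Proof.
by move=> bF; rewrite /Rintegral fineK// integrable_fin_num//;
  exact: bounded_measurable_integrable.
Qed.

End bounded_measurable_theory.

Section bounded_pushforward.
Context d d' (T : measurableType d) (S : measurableType d') (R : realType).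
Variables (Q : probability T R) (Q' : {measure set S -> \bar R}).
Variables (h : T -> S) (F : S -> R).
Hypotheses (mh : measurable_fun setT h)
  (hQ : forall A, measurable A -> Q' A = Q (h @^-1` A))
  (bF : bounded_measurable F).

Lemma integral_bounded_pushforward :
  (\int[Q']_y (F y)%:E = \int[Q]_x (F (h x))%:E)%E.
Proof.
rewrite (eq_measure_integral (pushforward Q h)); last by move=> A mA _; rewrite hQ.
rewrite integral_pushforward//; first by case: bF => /measurable_EFinP.
apply: (@bounded_measurable_integrable _ _ _ Q (F \o h)).
exact: bounded_measurable_comp.
Qed.

Lemma Rintegral_bounded_pushforward : \int[Q']_y F y = \int[Q]_x F (h x).
Proof. by rewrite /Rintegral integral_bounded_pushforward. Qed.

End bounded_pushforward.

Lemma measurable_ltr_set d (T : measurableType d) (R : realType) (f g : T -> R) :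
  measurable_fun setT f -> measurable_fun setT g ->
  measurable [set x | f x < g x].
Proof.
move=> mf mg; rewrite -[X in measurable X]setTI.
rewrite [X in measurable (_ `&` X)](_ : _ =
  (fun x => f x < g x) @^-1` [set true]); last by apply/seteqP; split.
exact: measurable_fun_ltr.
Qed.

(** * Measurability of convergence and almost sure subsequences *)

Section almost_sure_convergence.
Context d (T : measurableType d) (R : realType).

(** The thresholds [k.+1%:R^-1] turn the definition of a limit into countable set operations.
    Absolute continuity is later applied to the complement of this set. *)
Lemma measurable_cvg0 (s : nat -> T -> R) :
  (forall n, measurable_fun setT (s n)) ->
  measurable [set x | s n x @[n --> \oo] --> 0].
Proof.
move=> ms.
rewrite (_ : [set x | _] = \bigcap_k \bigcup_N \bigcap_(n in [set n | (N <= n)%N])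
    [set x | `|s n x| <= k.+1%:R^-1]).
  apply: bigcapT_measurable => k; apply: bigcupT_measurable => N.
  apply: bigcap_measurable => [|n _]; first by exists N => /=.
  rewrite (_ : [set x | _] = ~` [set x | k.+1%:R^-1 < `|s n x|]).
    apply: measurableC; apply: measurable_ltr_set => //.
    exact: measurableT_comp.
  by apply/seteqP; split=> x /=; rewrite leNgt => /negP.
apply/seteqP; split => x /=.
  move=> /cvgr0Pnorm_le sx k _.
  by have [N _ Nx] := sx k.+1%:R^-1 ltac:(by []); exists N => // n /= /Nx.
move=> sx; apply/cvgr0Pnorm_le => e e0.
(* For [k] the integer part of [e^-1], [k.+1] exceeds [e^-1], so the threshold is below [e]. *)
have [N _ Nx] := sx (Num.truncn e^-1) I.
exists N => // n /= Nn; apply: (le_trans (Nx n Nn)).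
rewrite -[leRHS]invrK lef_pV2 ?posrE ?invr_gt0//.
exact/ltW/truncnS_gt.
Qed.

(** Choosing integrals at most [1 / 2 ^ k.+1] makes the series of the chosen functions integrable,
    hence almost everywhere finite, and its terms tend to 0. The bound [k <= phi k] replaces
    monotonicity: it suffices for [phi] to tend to infinity. *)
Lemma cvg0_subseq_ae (Q : probability T R) (u : nat -> T -> R) :
  (forall n, bounded_measurable (u n)) -> (forall n x, 0 <= u n x) ->
  \int[Q]_x u n x @[n --> \oo] --> 0 ->
  exists2 phi : nat -> nat, (forall k, (k <= phi k)%N) &
    {ae Q, forall x, u (phi k) x @[k --> \oo] --> 0}.
Proof.
move=> bu u0 cu.
have /choice[phi phiP] k : exists n, (k <= n)%N /\
    \int[Q]_x u n x <= 1 / (2 ^ k.+1)%:R.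
  have e0 : 0 < 1 / (2 ^ k.+1)%:R :> R by rewrite divr_gt0// ltr0n expn_gt0.
  have [N _ Nu] := cvgr_lt _ cu _ e0.
  exists (maxn k N); split; first exact: leq_maxl.
  by apply/ltW/Nu => /=; exact: leq_maxr.
exists phi => [k|]; first by case: (phiP k).
have uphi0 k x : (0 <= (u (phi k) x)%:E)%E by rewrite lee_fin.
have mphi k : measurable_fun setT (fun x => (u (phi k) x)%:E).
  by apply/measurable_EFinP; case: (bu (phi k)).
have sfin : (\int[Q]_x \sum_(0 <= k <oo) (u (phi k) x)%:E < +oo)%E.
  rewrite integral_nneseries//.
  apply: (@le_lt_trans _ _ 1%:E); last exact: ltry.
  apply: le_trans (epsilon_trick0 predT ler01).
  apply: lee_nneseries => [k _ _|k _]; first exact: integral_ge0.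
  by rewrite -EFin_Rintegral// lee_fin; case: (phiP k).
have : Q.-integrable setT (fun x => \sum_(0 <= k <oo) (u (phi k) x)%:E)%E.
  apply/integrableP; split; first exact: ge0_emeasurable_sum.
  by under eq_integral do rewrite gee0_abs ?nneseries_ge0//.
move=> /(integrable_ae measurableT); apply: filterS => x /(_ I).
rewrite ge0_fin_numE ?nneseries_ge0// => sx.
have tl := nneseries_tail_cvg sx (fun k _ => uphi0 k x).
suff /fine_cvg : ((u (phi k) x)%:E @[k --> \oo] --> 0)%E by [].
(* The [k]-th term is at most the tail of the series from [k] on. *)
apply: squeeze_cvge (cvg_cst 0%E) tl; apply: nearW => k; rewrite uphi0/=.
have := @nneseries_lim_ge _ (fun i => (u (phi i) x)%:E) xpredT k k.+1
  (fun i _ _ => uphi0 i x).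
by rewrite big_nat1.
Qed.

End almost_sure_convergence.

(** * Averages of almost orthogonal variables *)

Section mean_square.
Context d (T : measurableType d) (R : realType) (Q : probability T R).

Lemma Rintegral_boundedD (F G : T -> R) :
  bounded_measurable F -> bounded_measurable G ->
  \int[Q]_x (F x + G x) = \int[Q]_x F x + \int[Q]_x G x.
Proof. by move=> bF bG; rewrite RintegralD//; exact: bounded_measurable_integrable. Qed.

Lemma Rintegral_boundedZ (c : R) (F : T -> R) : bounded_measurable F ->
  \int[Q]_x (c * F x) = c * \int[Q]_x F x.
Proof. by move=> bF; rewrite RintegralZl//; exact: bounded_measurable_integrable. Qed.

Lemma Rintegral_boundedN (F : T -> R) : bounded_measurable F ->
  \int[Q]_x (- F x) = - \int[Q]_x F x.
Proof.
move=> bF; rewrite -mulN1r -Rintegral_boundedZ//.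
by apply: eq_Rintegral => x _; rewrite mulN1r.
Qed.

Lemma le_Rintegral_bounded (F G : T -> R) :
  bounded_measurable F -> bounded_measurable G -> (forall x, F x <= G x) ->
  \int[Q]_x F x <= \int[Q]_x G x.
Proof. by move=> bF bG FG; apply: le_Rintegral => //; exact: bounded_measurable_integrable. Qed.

Lemma Rintegral_bounded_sum (F : nat -> T -> R) n :
  (forall k, bounded_measurable (F k)) ->
  \int[Q]_x (\sum_(0 <= k < n) F k x) = \sum_(0 <= k < n) \int[Q]_x F k x.
Proof.
move=> bF; elim: n => [|n IH].
  rewrite big_geq//; under eq_Rintegral do rewrite big_geq//.
  exact: Rintegral_probability_cst.
rewrite big_nat_recr//= -IH -Rintegral_boundedD//; last exact: bounded_measurable_sum.
by apply: eq_Rintegral => x _; rewrite big_nat_recr.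
Qed.

Variables (U : nat -> T -> R) (B : R).
Hypothesis bU : forall k, bounded_measurable (U k).
Hypothesis U2 : forall k, \int[Q]_x (U k x * U k x) <= B.
Hypothesis UU : forall i k, (i < k)%N -> \int[Q]_x (U i x * U k x) <= k.+1%:R^-1.

(** Expanding the square of the next partial sum adds a square, at most [B], and twice a cross term.
    The bound in [UU] depends on the larger index alone, so the cross term is a sum of [n] numbers
    at most [n.+1%:R^-1], hence at most 1. *)
Lemma mean_square_sum n :
  \int[Q]_x (series (U ^~ x) n * series (U ^~ x) n) <= n%:R * (B + 2).
Proof.
have bS m : bounded_measurable (fun x => series (U ^~ x) m).
  exact: bounded_measurable_sum.
elim: n => [|n IH].
  under eq_Rintegral do rewrite /series/= big_geq// mul0r.
  by rewrite Rintegral_probability_cst mul0r.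
rewrite (_ : \int[Q]_x _ = \int[Q]_x (series (U ^~ x) n * series (U ^~ x) n
    + (2 * (series (U ^~ x) n * U n x) + U n x * U n x))); last first.
  by apply: eq_Rintegral => x _; rewrite /series/= big_nat_recr//=; ring.
rewrite Rintegral_boundedD; [|exact: bounded_measurableM|]; last first.
  apply: bounded_measurableD; last exact: bounded_measurableM.
  apply: bounded_measurableM; first exact: bounded_measurable_cst.
  exact: bounded_measurableM.
rewrite Rintegral_boundedD; [| |exact: bounded_measurableM]; last first.
  apply: bounded_measurableM; first exact: bounded_measurable_cst.
  exact: bounded_measurableM.
rewrite Rintegral_boundedZ; last exact: bounded_measurableM.
have SU : \int[Q]_x (series (U ^~ x) n * U n x) <= 1.
  rewrite (_ : \int[Q]_x _ = \sum_(0 <= k < n) \int[Q]_x (U k x * U n x)); last first.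
    rewrite -Rintegral_bounded_sum; last by move=> k; exact: bounded_measurableM.
    by apply: eq_Rintegral => x _; rewrite /series/= mulr_suml.
  apply: (@le_trans _ _ (\sum_(0 <= k < n) n.+1%:R^-1)).
    by apply: ler_sum_nat => k /andP[_ kn]; exact: UU.
  rewrite sumr_const_nat subn0 -[_ *+ n]mulr_natl ler_pdivrMr ?ltr0n// mul1r ler_nat//.
have := U2 n; rewrite -natr1; lra.
Qed.

Lemma mean_square_average_cvg0 :
  \int[Q]_x (arithmetic_mean (U ^~ x) n ^+ 2) @[n --> \oo] --> 0.
Proof.
have B0 : 0 <= B.
  by rewrite (le_trans _ (U2 0))// Rintegral_ge0// => x _; rewrite -expr2 sqr_ge0.
apply: (@squeeze_cvgr _ _ _ _ (cst 0) (fun n => (B + 2) * harmonic n)).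
- apply: nearW => n; apply/andP; split.
    by rewrite Rintegral_ge0// => x _; exact: sqr_ge0.
  (* The mean of index [n] has [n.+1] terms, so dividing the linear bound by [n.+1 ^ 2] leaves
     [(B + 2) / n.+1]. *)
  rewrite (_ : \int[Q]_x _ = n.+1%:R^-1 ^+ 2 *
      \int[Q]_x (series (U ^~ x) n.+1 * series (U ^~ x) n.+1)); last first.
    rewrite -Rintegral_boundedZ; last first.
      by apply: bounded_measurableM; exact: bounded_measurable_sum.
    by apply: eq_Rintegral => x _; rewrite /arithmetic_mean/= exprMn -expr2.
  apply: (@le_trans _ _ (n.+1%:R^-1 ^+ 2 * (n.+1%:R * (B + 2)))).
    by rewrite ler_wpM2l// ?sqr_ge0//; exact: mean_square_sum.
  by rewrite expr2 -mulrA mulKf// mulrC.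
- exact: cvg_cst.
- by rewrite -(mulr0 (B + 2)); apply: cvgMr; exact: cvg_harmonic.
Qed.

Lemma average_subseq_ae_cvg0 : exists2 phi : nat -> nat,
  (forall k, (k <= phi k)%N) &
  {ae Q, forall x, arithmetic_mean (U ^~ x) (phi k) @[k --> \oo] --> 0}.
Proof.
have [|||phi phik cphi] := @cvg0_subseq_ae _ _ _ Q
    (fun n x => arithmetic_mean (U ^~ x) n ^+ 2).
- move=> n; rewrite /= (_ : (fun x => _) = (fun x =>
      arithmetic_mean (U ^~ x) n * arithmetic_mean (U ^~ x) n)) //.
  have bA : bounded_measurable (fun x => arithmetic_mean (U ^~ x) n).
    apply: bounded_measurableM; first exact: bounded_measurable_cst.
    exact: bounded_measurable_sum.
  exact: bounded_measurableM.
- by move=> n x; exact: sqr_ge0.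
- exact: mean_square_average_cvg0.
exists phi => //; apply: filterS cphi => x cx.
apply/cvgr0Pnorm_lt => e e0.
move/cvgr0Pnorm_lt: cx => /(_ _ (exprn_gt0 2 e0)); apply: filterS => k.
by rewrite normrX ltr_pXn2r// nnegrE ltW.
Qed.

End mean_square.

(** * Laws of Markov chains on trajectories *)

Section trajectory_space.
Context d (T : measurableType d).

(** These are the events on which [is_chain_law] prescribes the measure; they form a pi-system
    generating the product sigma-algebra. *)
Definition cylinder (n : nat) (A : nat -> set T) : set (nat -> T) :=
  [set w | forall i, (i <= n)%N -> A i (w i)].

Definition measurable_cylinders : set (set (nat -> T)) :=
  [set C | exists n A, (forall i, measurable (A i)) /\ C = cylinder n A].

Lemma measurable_coordinate n :
  measurable_fun setT (fun w : trajectory T => w n).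
Proof.
move=> _ Y mY; apply: sub_sigma_algebra.
by exists n => //; exists Y.
Qed.

Lemma cylinderT n : cylinder n (fun=> setT) = setT.
Proof. by apply/seteqP; split. Qed.

Lemma measurable_cylinder n (A : nat -> set T) : (forall i, measurable (A i)) ->
  measurable (cylinder n A : set (trajectory T)).
Proof.
move=> mA.
rewrite (_ : cylinder n A = \bigcap_(i in [set i | (i <= n)%N])
    ((fun w : trajectory T => w i) @^-1` A i)); last by apply/seteqP; split.
apply: bigcap_measurable => [|i _]; first by exists 0%N.
by rewrite -[X in measurable X]setTI; exact: measurable_coordinate.
Qed.

Lemma measurable_cylindersE :
  @measurable _ (trajectory T) = <<s measurable_cylinders >>.
Proof.
apply/seteqP; split.
  apply: smallest_sub; first exact: smallest_sigma_algebra.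
  move=> _ [n _ [B mB <-]]; apply: sub_sigma_algebra.
  (* An event on one coordinate is a cylinder with all other factors equal to the whole space. *)
  pose A i := if i == n then B else setT.
  exists n, A; split=> [i|]; first by rewrite /A; case: ifP.
  rewrite setTI; apply/seteqP; split=> w /= Bw.
    by move=> i _; rewrite /A; case: eqP => // ->.
  by have := Bw n (leqnn n); rewrite /A eqxx.
apply: smallest_sub; first exact: (@sigma_algebra_measurable _ (trajectory T)).
by move=> _ [n [A [mA ->]]]; exact: measurable_cylinder.
Qed.

Lemma measurable_cylinders_setI : setI_closed measurable_cylinders.
Proof.
move=> _ _ [n [A [mA ->]]] [m [B [mB ->]]].
(* Factors beyond the length of a cylinder impose nothing, so they are reset to [setT] before both
   are extended to the common length. *)
pose A' i := if (i <= n)%N then A i else setT.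
pose B' i := if (i <= m)%N then B i else setT.
exists (maxn n m), (fun i => A' i `&` B' i); split=> [i|].
  by apply: measurableI; rewrite /A' /B'; case: ifP.
apply/seteqP; split=> w /=.
  move=> [wA wB] i _; split; rewrite /A' /B'.
    by case: ifPn => // /wA.
  by case: ifPn => // /wB.
move=> wAB; split=> i ni.
  have [+ _] := wAB i (leq_trans ni (leq_maxl _ _)).
  by rewrite /A' ni.
have [_] := wAB i (leq_trans ni (leq_maxr _ _)).
by rewrite /B' ni.
Qed.

Lemma measure_cylinders_unique (R : realType)
    (Q : probability (trajectory T) R)
    (Q' : {measure set (trajectory T) -> \bar R}) :
  (forall n A, (forall i, measurable (A i)) ->
    Q (cylinder n A) = Q' (cylinder n A)) ->
  forall A, measurable A -> Q A = Q' A.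
Proof.
move=> QQ' A.
apply: (@measure_unique _ R (trajectory T) measurable_cylinders (fun=> setT)).
- exact: measurable_cylindersE.
- exact: measurable_cylinders_setI.
- by move=> _; exists 0%N, (fun=> setT); rewrite cylinderT.
- exact: bigcup_const.
- by move=> _ [n [B [mB ->]]]; exact: QQ'.
- by move=> _; rewrite -ge0_fin_numE// fin_num_measure.
Qed.

Definition shift (w : trajectory T) : trajectory T := fun n => w n.+1.

Lemma measurable_shift : measurable_fun setT shift.
Proof.
apply: (measurability _ measurable_cylindersE) => _ [_ [n [A [mA ->]]] <-].
apply: measurableI => //.
(* Pulling back by [shift] moves each constraint one step later and leaves the initial state
   free. *)
pose B i := if i is j.+1 then A j else setT.
rewrite (_ : _ @^-1` _ = cylinder n.+1 B).
  by apply: (measurable_cylinder n.+1); case=> [|i] /=; [exact: measurableT|exact: mA].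
apply/seteqP; split=> w /= wA.
  by case=> // i ni; exact: wA.
by move=> i ni; exact: (wA i.+1).
Qed.

End trajectory_space.

(** * Disintegration, marginals and stationarity of the chain laws *)

Section chain_laws.
Context d (T : measurableType d) (R : realType) (P : R.-pker T ~> T).
Local Open Scope ereal_scope.

Lemma iterated_kernel_ge0 n A x : 0 <= iterated_kernel P n A x.
Proof.
elim: n A x => [|n IH] A x /=; first exact: lee01.
by apply: integral_ge0 => y _; exact: IH.
Qed.

Lemma measurable_iterated_kernel n A : (forall i, measurable (A i)) ->
  measurable_fun setT (iterated_kernel P n A).
Proof.
elim: n A => [|n IH] A mA /=; first exact: measurable_cst.
(* Restricting the integrand replaces the domain [A 0] by the whole space, where integration against
   a kernel preserves measurability. *)
under eq_fun do rewrite integral_mkcond.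
apply: (measurable_fun_integral_kernel (l := P)).
- by move=> U mU; exact: measurable_kernel.
- by move=> y; rewrite erestrict_ge0// => z _; exact: iterated_kernel_ge0.
- by apply: (measurable_restrictT _ (mA 0%N)).1; apply: measurable_funTS; exact: IH.
Qed.

Variable Pr : probability T R -> probability (trajectory T) R.
Hypothesis Pr_law : forall nu, is_chain_law P nu (Pr nu).

Lemma Pr_cylinder nu n A : (forall i, measurable (A i)) ->
  Pr nu (cylinder n A) =
  \int[nu]_(x in A 0%N) iterated_kernel P n (fun i => A i.+1) x.
Proof. exact: Pr_law. Qed.

Lemma Pr_dirac_cylinder x n A : (forall i, measurable (A i)) ->
  Pr \d_x (cylinder n A) =
  ((iterated_kernel P n (fun i => A i.+1)) \_ (A 0%N)) x.
Proof.
move=> mA; rewrite Pr_cylinder// integral_mkcond integral_dirac//.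
  by rewrite diracT mul1e.
apply: (measurable_restrictT _ (mA 0%N)).1; apply: measurable_funTS.
exact: measurable_iterated_kernel.
Qed.

(** On cylinders the claim is the defining formula, and a Dynkin argument extends it. Measurability
    in the starting point is carried through the same induction, since the complement and union
    steps integrate that function. *)
Lemma Pr_disintegration nu B : measurable B ->
  measurable_fun setT (fun x => Pr \d_x B) /\
  Pr nu B = \int[nu]_x Pr \d_x B.
Proof.
rewrite measurable_cylindersE.
pose H B := measurable_fun setT (fun x => Pr \d_x B) /\
  Pr nu B = \int[nu]_x Pr \d_x B.
move: B; apply: (dynkin_induction (P := H) (measurable_cylindersE T)).
- exact: measurable_cylinders_setI.
- split; first by under eq_fun do rewrite probability_setT; exact: measurable_cst.
  rewrite probability_setT; under eq_integral do rewrite probability_setT.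
  by rewrite integral_cst//= probability_setT mul1e.
- move=> _ [n [A [mA ->]]]; split.
    under eq_fun do rewrite Pr_dirac_cylinder//.
    apply: (measurable_restrictT _ (mA 0%N)).1; apply: measurable_funTS.
    exact: measurable_iterated_kernel.
  rewrite Pr_cylinder// integral_mkcond; apply: eq_integral => x _.
  by rewrite Pr_dirac_cylinder.
- move=> B mB [mPB PB].
  have PC x : Pr \d_x (~` B) = 1 - Pr \d_x B by exact: probability_setC.
  rewrite /H; under eq_fun do rewrite PC.
  split; first exact: emeasurable_funB.
  rewrite probability_setC// PB.
  have i1 : nu.-integrable setT (cst 1 : T -> \bar R).
    exact: (finite_measure_integrable_cst nu 1%R measurableT).
  rewrite integralB//; first by rewrite integral_cst//= probability_setT mul1e.
  apply: (le_integrable _ _ _ i1) => // x _ /=.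
  by rewrite !gee0_abs ?lee01// normr1 probability_le1.
- move=> F mF tF HF.
  have PF x : Pr \d_x (\bigcup_k F k) = \sum_(0 <= k <oo) Pr \d_x (F k).
    by rewrite measure_semi_bigcup//; exact: bigcupT_measurable.
  have mPF k : measurable_fun setT (fun x => Pr \d_x (F k)) by case: (HF k).
  rewrite /H; under eq_fun do rewrite PF.
  split; first exact: ge0_emeasurable_sum.
  rewrite measure_semi_bigcup//; last exact: bigcupT_measurable.
  rewrite integral_nneseries//.
  by apply: eq_eseriesr => n _; case: (HF n).
Qed.

(** Both [nstep] and [iterated_kernel] split off the first transition, so the induction integrates
    the hypothesis against [P x]. *)
Lemma Pr_coordinate x n B : measurable B ->
  Pr \d_x ((fun w : trajectory T => w n) @^-1` B) = nstep P n x B.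
Proof.
move=> mB; pose A i := if i == n then B else setT.
rewrite (_ : _ @^-1` _ = cylinder n A); last first.
  apply/seteqP; split=> w /= Bw.
    by move=> i _; rewrite /A; case: eqP => // ->.
  by have := Bw n (leqnn n); rewrite /A eqxx.
rewrite Pr_dirac_cylinder => [|i]; last by rewrite /A; case: ifP.
rewrite {}/A; elim: n x => [|n IH] x /=.
  by rewrite patchE diracE; case: ifP.
rewrite patchE in_setT /= integral_mkcond.
by apply: eq_integral => y _; rewrite -IH.
Qed.

Section invariance.
Variable mu : probability T R.
Hypothesis mu_invariant : invariant_measure P mu.

Lemma Pr_initial_law B : measurable B ->
  Pr mu ((fun w : trajectory T => w 0%N) @^-1` B) = mu B.
Proof.
move=> mB; rewrite (_ : _ @^-1` _ = cylinder 0 (fun=> B)); last first.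
  apply/seteqP; split=> w /= Bw; last exact: Bw.
  by move=> i; rewrite leqn0 => /eqP ->.
by rewrite Pr_cylinder//= integral_cst// mul1e.
Qed.

(** The right side is the integral of [h] against the composition of [mu] with [P], a measure that
    agrees with [mu] by invariance. *)
Lemma invariant_measure_integral (h : T -> \bar R) :
  (forall x, 0 <= h x) -> measurable_fun setT h ->
  \int[mu]_x h x = \int[mu]_x \int[P x]_y h y.
Proof.
move=> h0 mh.
(* [mu] is seen as a kernel from a one-point space, so that the integral formula for composed
   kernels applies. *)
pose l := kprobability (measurable_cst (mu : pprobability T R) : measurable_fun [set: unit] _).
rewrite -(integral_kcomp l (kernel.kernel_snd P) tt h0 mh).
by apply: eq_measure_integral => A mA _; apply: mu_invariant.
Qed.

(** By uniqueness on cylinders it is enough to drop a free initial state, which is invariance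
    applied to the restricted iterated kernel. *)
Lemma Pr_shift B : measurable B -> Pr mu (@shift _ T @^-1` B) = Pr mu B.
Proof.
pose sh : {mfun trajectory T >-> trajectory T} :=
  HB.pack (@shift _ T) (isMeasurableFun.Build _ _ _ _ _ (@measurable_shift _ T)).
move=> mB; apply/esym.
apply: (@measure_cylinders_unique _ T R (Pr mu) (distribution (Pr mu) sh)) => // n A mA.
pose A' i := if i is j.+1 then A j else setT.
transitivity (Pr mu (cylinder n.+1 A')); last first.
  congr (Pr mu _); apply/seteqP; split=> w /= wA; first by move=> i ni; exact: (wA i.+1).
  by case=> // i ni; exact: wA.
rewrite !Pr_cylinder//; last by case=> [|i] /=; [exact: measurableT|exact: mA].
rewrite /= integral_mkcond [LHS]invariant_measure_integral.
- by apply: eq_integral => x _; rewrite [RHS]integral_mkcond.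
- by move=> y; rewrite erestrict_ge0// => z _; exact: iterated_kernel_ge0.
- apply: (measurable_restrictT _ (mA 0%N)).1; apply: measurable_funTS.
  by apply: measurable_iterated_kernel => i; exact: mA.
Qed.

Lemma Pr_shift_Rintegral (F : trajectory T -> R) : bounded_measurable F ->
  (\int[Pr mu]_w F (shift w) = \int[Pr mu]_w F w)%R.
Proof.
move=> bF; apply/esym/Rintegral_bounded_pushforward => //.
  exact: measurable_shift.
by move=> B mB; rewrite Pr_shift.
Qed.

Lemma Pr_stationary (Z : T -> R) m k : bounded_measurable Z ->
  (\int[Pr mu]_w (Z (w m) * Z (w (m + k)%N)) =
   \int[Pr mu]_w (Z (w 0%N) * Z (w k)))%R.
Proof.
move=> bZ; elim: m => [|m <-]; first by under eq_Rintegral do rewrite add0n.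
rewrite -[RHS]Pr_shift_Rintegral//.
apply: (@bounded_measurableM _ (trajectory T) R (fun w => Z (w m))
  (fun w => Z (w (m + k)%N))).
all: exact: (bounded_measurable_comp (measurable_coordinate _)).
Qed.

(** This is mixing for [f = g = Z]; the limiting product vanishes because [X_0] has law [mu] under
    [Pr mu]. *)
Lemma mixing_decorrelation (Z : T -> R) : mixing (Pr mu) ->
  bounded_measurable Z -> (\int[mu]_x Z x = 0)%R ->
  (\int[Pr mu]_w (Z (w 0%N) * Z (w n)) @[n --> \oo] --> 0)%R.
Proof.
move=> mix bZ Z0.
have bfZ : bounded_fun Z.
  case: bZ => _ [C ZC]; exists C; split; first exact: num_real.
  by move=> D CD x _; apply: le_trans (ZC x) (ltW CD).
have bc n : bounded_measurable (fun w : trajectory T => Z (w n)).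
  exact: (bounded_measurable_comp (measurable_coordinate n)).
have EZZ n : 'E_(Pr mu)[fun w => (Z (w 0%N) * Z (w n))%R] =
    (\int[Pr mu]_w (Z (w 0%N) * Z (w n)))%R%:E.
  by rewrite unlock EFin_Rintegral//; exact: bounded_measurableM.
have EZ : 'E_(Pr mu)[fun w => Z (w 0%N)] = 0.
  rewrite unlock -(EFin_Rintegral (Pr mu))//.
  rewrite -(Rintegral_bounded_pushforward (Q' := mu) (measurable_coordinate 0)) ?Z0//.
  by move=> A mA; rewrite Pr_initial_law.
have [mZ _] := bZ; have := mix _ _ mZ bfZ mZ bfZ.
rewrite EZ mule0; under eq_fun do rewrite EZZ.
by move/fine_cvg.
Qed.

End invariance.

End chain_laws.

(** * Generalized couplings of a mixing chain *)

Lemma cvg_infty_ge_id (phi : nat -> nat) : (forall k, (k <= phi k)%N) ->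
  phi k @[k --> \oo] --> \oo.
Proof.
move=> phik A [N _ NA]; exists N => // k Nk; apply: NA.
exact: leq_trans Nk (phik k).
Qed.

Lemma bounded_ae_cvg0_Rintegral d (T : measurableType d) (R : realType)
    (Q : probability T R) (s : nat -> T -> R) (C : R) :
  (forall n, measurable_fun setT (s n)) -> (forall n x, `|s n x| <= C) ->
  {ae Q, forall x, s n x @[n --> \oo] --> 0} ->
  \int[Q]_x s n x @[n --> \oo] --> 0.
Proof.
move=> ms sC s0.
have [| | | | |_ _] := @dominated_convergence _ _ _ Q setT measurableT
    (fun n x => (s n x)%:E) (cst 0%E) (cst C%:E).
- by move=> n; exact/measurable_EFinP.
- exact: measurable_cst.
- by apply: filterS s0 => x sx _; exact: cvg_EFin (nearW _ _) sx.
- exact: finite_measure_integrable_cst.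
- by apply: aeW => x n _ /=; rewrite lee_fin.
by rewrite integral0 => /fine_cvg.
Qed.

Section generalized_coupling_convergence.
Context d (T : measurableType d) (R : realType) (P : R.-pker T ~> T).
Variable Pr : probability T R -> probability (trajectory T) R.
Hypothesis Pr_law : forall nu, is_chain_law P nu (Pr nu).
Variable mu : probability T R.
Hypothesis mu_invariant : invariant_measure P mu.
Hypothesis mu_mixing : mixing (Pr mu).

(* Thinning the times [h _] makes the sampled values almost orthogonal. *)
Lemma mixing_sparse_average (Z : T -> R) (h : nat -> nat) :
  bounded_measurable Z -> \int[mu]_x Z x = 0 -> (forall k, (k <= h k)%N) ->
  exists n phi : nat -> nat, [/\ forall k, (k <= n k)%N,
    forall k, (k <= phi k)%N, forall k, exists j, n k = h j &
    {ae Pr mu, forall w, arithmetic_mean (fun k => Z (w (n k))) (phi i)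
       @[i --> \oo] --> 0}].
Proof.
move=> bZ Z0 hk.
have ca := mixing_decorrelation Pr_law mu_mixing bZ Z0.
pose a k := \int[Pr mu]_w (Z (w 0%N) * Z (w k)).
(* [N_ k] is a time lag from which on all correlations are at most [k.+1%:R^-1]. *)
have /choice[N_ N_a] k : exists N, forall m, (N <= m)%N -> `|a m| <= k.+1%:R^-1.
  have [N _ Na] := cvgr0_norm_le _ ca k.+1%:R^-1 ltac:(by []).
  by exists N => m; exact: Na.
(* As [h] dominates the identity, time [n k] lies at least [N_ k] after every earlier chosen time;
   the extra 1 makes the times strictly increasing. *)
pose n := fix n k := if k is j.+1 then h (n j + N_ j.+1 + 1)%N else h 0%N.
have nS k : (n k + N_ k.+1 < n k.+1)%N by rewrite /= (leq_trans _ (hk _))// addn1.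
have nlt i k : (i < k)%N -> (n i + N_ k <= n k)%N.
  elim: k => // k IH; rewrite ltnS leq_eqVlt => /predU1P[->|/IH ik].
    exact/ltnW/nS.
  rewrite (leq_trans _ (ltnW (nS k)))// leq_add2r.
  by rewrite (leq_trans _ ik)// leq_addr.
have bU k : bounded_measurable (fun w : trajectory T => Z (w (n k))).
  exact: (bounded_measurable_comp (measurable_coordinate _)).
have [| |phi phik cphi] := @average_subseq_ae_cvg0 _ (trajectory T) R (Pr mu)
    (fun k w => Z (w (n k))) (a 0%N) bU.
- move=> k; have := Pr_stationary Pr_law mu_invariant (n k) 0 bZ.
  by rewrite addn0 => ->.
(* With [n k] written as [n i] plus a lag, stationarity reduces the correlation to [a] at that
   lag. *)
- move=> i k ik; rewrite -(subnKC (leq_trans (leq_addr _ _) (nlt _ _ ik))).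
  rewrite (Pr_stationary Pr_law)// (le_trans (ler_norm _))// N_a//.
  by rewrite leq_subRL ?nlt// (leq_trans (leq_addr _ _) (nlt _ _ ik)).
exists n, phi; split=> //.
  elim=> [|k IH]; first exact: leq0n.
  by rewrite (leq_ltn_trans IH)// (leq_ltn_trans _ (nS k))// leq_addr.
by case=> [|k] /=; eexists.
Qed.

(** By disintegration a nonnegative function has integral zero, so it vanishes almost everywhere. *)
Lemma ae_Pr_dirac A : measurable A -> Pr mu A = 0%E ->
  {ae mu, forall y, Pr \d_y A = 0%E}.
Proof.
move=> mA; have [mPA ->] := Pr_disintegration Pr_law mu mA => PA0.
have : ae_eq mu setT (fun y => Pr \d_y A) (cst 0%E).
  apply/ae_eq_integral_abs => //.
  by under eq_integral do rewrite gee0_abs//.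
by apply: filterS => y; apply.
Qed.

Variables (x : T) (M : set T).
Hypotheses (M_measurable : measurable M) (M_pos : (0 < mu M)%E).

(** The two absolute continuities serve in opposite directions: one carries null sets from [Pr \d_y]
    to [xi], the other from [xi] to [Pr \d_x]. The coupling enters only through the convergence in
    mean of the differences. *)
Lemma generalized_coupling_liminf (Z : T -> R) (eps : R) :
  bounded_measurable Z -> \int[mu]_x Z x = 0 -> 0 < eps ->
  (forall y, M y -> exists xi : probability (trajectory T * trajectory T)%type R,
    [/\ generalized_coupling (Pr \d_x) (Pr \d_y) xi,
        Pr \d_x `<< pushforward xi fst &
        \int[xi]_w `|Z (w.1 n) - Z (w.2 n)| @[n --> \oo] --> 0]) ->
  \forall n \near \oo, - eps <= \int[Pr \d_x]_w Z (w n).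
Proof.
move=> bZ Z0 eps0 coupling; apply: contrapT => neps.
have /choice[h hP] k : exists n, (k <= n)%N /\ \int[Pr \d_x]_w Z (w n) < - eps.
  apply: contrapT => /forallNP nk; apply: neps; exists k => // m km /=.
  by rewrite leNgt; apply/negP => Zm; exact: (nk m).
have [|n [phi [nk phik nh [A [mA A0 Acov]]]]] := @mixing_sparse_average Z h bZ Z0.
  by move=> k; case: (hP k).
(* Otherwise [M] would be contained in a [mu]-null set, against [M_pos]. *)
have [y My yA] : exists2 y, M y & Pr \d_y A = 0%E.
  apply: contrapT => /forall2NP nM.
  have [B [mB B0 BA]] := ae_Pr_dirac mA A0.
  have : (mu M <= mu B)%E.
    apply: le_measure; rewrite ?inE// => z Mz; apply: BA => /= zA.
    by case: (nM z).
  by rewrite B0 leNgt M_pos.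
have [xi [[_ xi2] xi1 xiZ]] := coupling _ My.
pose D k (w : trajectory T * trajectory T) := `|Z (w.1 (n k)) - Z (w.2 (n k))|.
have bc k : bounded_measurable (fun w : trajectory T => Z (w k)).
  exact: (bounded_measurable_comp (measurable_coordinate k)).
have bD k : bounded_measurable (D k).
  apply: bounded_measurable_norm; apply: bounded_measurableD.
    exact: (bounded_measurable_comp measurable_fst (bc (n k))).
  apply: bounded_measurableN.
  exact: (bounded_measurable_comp measurable_snd (bc (n k))).
have bmD K : bounded_measurable (fun w => arithmetic_mean (D ^~ w) K).
  apply: bounded_measurableM; first exact: bounded_measurable_cst.
  exact: bounded_measurable_sum.
have cD : \int[xi]_w arithmetic_mean (D ^~ w) (phi K) @[K --> \oo] --> 0.
  have -> : (fun K => \int[xi]_w arithmetic_mean (D ^~ w) (phi K)) =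
      arithmetic_mean (fun k => \int[xi]_w D k w) \o phi.
    apply/funext => K; rewrite /arithmetic_mean/= Rintegral_boundedZ.
      by rewrite Rintegral_bounded_sum.
    exact: bounded_measurable_sum.
  apply: cvg_comp (cvg_infty_ge_id phik) _; apply: cesaro.
  have := cvg_comp _ _ (cvg_infty_ge_id nk) xiZ; exact.
(* A second extraction [psi] inside [phi] turns convergence in mean into [xi]-almost sure
   convergence, and keeps the convergence already known for the second coordinate. *)
have [| |psi psik [B [mB B0 Bcov]]] := cvg0_subseq_ae _ _ cD; first by [].
  move=> K w; rewrite /arithmetic_mean/= mulr_ge0// sumr_ge0// => k _.
  exact: normr_ge0.
pose s i (w : trajectory T) := arithmetic_mean (fun k => Z (w (n k))) (phi (psi i)).
have bs i : bounded_measurable (s i).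
  apply: bounded_measurableM; first exact: bounded_measurable_cst.
  exact: (bounded_measurable_sum _ (fun k => bc (n k))).
have ms i : measurable_fun setT (s i) by case: (bs i).
have msnd C : measurable C -> measurable (snd @^-1` C : set (trajectory T * trajectory T)).
  by move=> mC; rewrite -[X in measurable X]setTI; exact: measurable_snd.
have mfst C : measurable C -> measurable (fst @^-1` C : set (trajectory T * trajectory T)).
  by move=> mC; rewrite -[X in measurable X]setTI; exact: measurable_fst.
have xA : xi (snd @^-1` A) = 0%E.
  by apply: (xi2 A) => //; exact/measure0_null_setP.
have AB0 : xi (snd @^-1` A `|` B) = 0%E.
  apply/eqP; rewrite eq_le measure_ge0 andbT.
  apply: (le_trans (measureU2 _ (msnd _ mA) mB)).
  by rewrite -[leRHS]adde0; apply: leeD; rewrite le_eqVlt; apply/orP; left; exact/eqP.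
(* Off this [xi]-null set the first average is bounded by the mean of the differences plus the
   second average. *)
have sAB w : ~ (snd @^-1` A `|` B) w -> s i w.1 @[i --> \oo] --> 0.
  move=> /not_orP[/= wA wB].
  have cY : s i w.2 @[i --> \oo] --> 0.
    have : arithmetic_mean (fun k => Z (w.2 (n k))) (phi i) @[i --> \oo] --> 0.
      by apply: contrapT => c; exact: (wA (Acov _ c)).
    by move=> c; have := cvg_comp _ _ (cvg_infty_ge_id psik) c; exact.
  have cXY : arithmetic_mean (D ^~ w) (phi (psi i)) @[i --> \oo] --> 0.
    by apply: contrapT => c; exact: (wB (Bcov _ c)).
  have cb : arithmetic_mean (D ^~ w) (phi (psi i)) + `|s i w.2| @[i --> \oo] --> 0.
    rewrite -[0]addr0 -{2}(normr0 R); apply: cvgD => //.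
    exact: cvg_norm.
  have cbN : - (arithmetic_mean (D ^~ w) (phi (psi i)) + `|s i w.2|) @[i --> \oo] --> 0.
    by rewrite -oppr0; exact: cvgN.
  apply: (squeeze_cvgr _ cbN cb).
  apply: nearW => i; rewrite -ler_norml.
  rewrite -lerBlDr (le_trans (lerB_dist _ _))//.
  rewrite /s /arithmetic_mean /series/= -mulrBr normrM ger0_norm//.
  by rewrite ler_wpM2l// -sumrB ler_norm_sum.
have mG := measurable_cvg0 ms.
have sG : {ae Pr \d_x, forall w, s i w @[i --> \oo] --> 0}.
  set G := [set w | _] in mG; exists (~` G); split=> //; first exact: measurableC.
  apply: (xi1 (~` G) _ _ (measurableC mG)) => // C mC CG.
  rewrite /pushforward; apply/eqP; rewrite -measure_le0 -AB0.
  apply: le_measure; rewrite ?inE; [exact: mfst|exact: (measurableU _ _ (msnd _ mA) mB)|].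
  move=> w Cw; have [//|/sAB sw] := pselect ((snd @^-1` A `|` B) w).
  by exfalso; exact: (CG _ Cw sw).
have [_ [C ZC]] := bZ.
have cs : \int[Pr \d_x]_w s i w @[i --> \oo] --> 0.
  apply: (bounded_ae_cvg0_Rintegral (C := C)) => // i w.
  rewrite /s /arithmetic_mean/= normrM ger0_norm// ler_pdivrMl// /series/=.
  rewrite (le_trans (ler_norm_sum _ _ _))//.
  rewrite (le_trans (ler_sum_nat (fun k _ => ZC _)))//.
  by rewrite sumr_const_nat subn0 mulr_natl.
(* Every [n k] is some [h j], so each term of the average has expectation below [- eps]; this
   contradicts [cs]. *)
have se i : \int[Pr \d_x]_w s i w <= - eps.
  rewrite /s /arithmetic_mean/= Rintegral_boundedZ; last first.
    exact: (bounded_measurable_sum _ (fun k => bc (n k))).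
  rewrite ler_pdivrMl// /series/= (Rintegral_bounded_sum _ _ (fun k => bc (n k))).
  apply: (@le_trans _ _ (\sum_(0 <= k < (phi (psi i)).+1) - eps)).
    by apply: ler_sum_nat => k _; have [j ->] := nh k; apply/ltW; case: (hP j).
  by rewrite sumr_const_nat subn0 mulr_natl.
have [|N _ /(_ N (leqnn N))] := cvgr_gt _ cs (- eps); first by rewrite oppr_lt0.
by rewrite /= ltNge se.
Qed.

End generalized_coupling_convergence.

(** * Lipschitz approximation *)

Section lipschitz_minorants.
Context (R : realType) (T : choiceType) (d : metric_on R T).

Lemma metric_on_ge0 x y : 0 <= d x y.
Proof.
have := dist_triangle d y x x; rewrite distxx (dist_sym d y x); lra.
Qed.

Variables (f : T -> R) (C : R).
Hypothesis f_bounded : forall y, `|f y| <= C.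

(** The infimal convolution of [f] with [k d], or Pasch-Hausdorff envelope. *)
Definition lipschitz_minorant (k : nat) (x : T) : R :=
  inf (range (fun y => f y + k%:R * d x y)).

(** Ensures that [inf] is taken over a set bounded below, so that it is a true infimum and no
    default value. *)
Let lower y k x : - C <= f y + k%:R * d x y.
Proof.
rewrite -[- C]addr0 lerD ?mulr_ge0 ?metric_on_ge0//.
by have := f_bounded y; rewrite ler_norml => /andP[].
Qed.

Let minorant_le k x y : lipschitz_minorant k x <= f y + k%:R * d x y.
Proof.
apply: ge_inf; last by exists y.
by exists (- C) => _ [z _ <-]; exact: lower.
Qed.

Lemma lipschitz_minorant_le k x : lipschitz_minorant k x <= f x.
Proof. by rewrite (le_trans (minorant_le k x x))// distxx mulr0 addr0. Qed.

Lemma lipschitz_minorant_bounded k x : `|lipschitz_minorant k x| <= C.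
Proof.
have := f_bounded x; rewrite !ler_norml => /andP[_ fC].
rewrite (le_trans (lipschitz_minorant_le k x) fC) andbT.
by apply: lb_le_inf; [exists (f x + k%:R * d x x), x|move=> _ [y _ <-]].
Qed.

Lemma lipschitz_minorant_lipschitz k x y :
  `|lipschitz_minorant k x - lipschitz_minorant k y| <= k%:R * d x y.
Proof.
have half u v : lipschitz_minorant k u - lipschitz_minorant k v <= k%:R * d u v.
  rewrite lerBlDl -lerBlDr; apply: lb_le_inf.
    by exists (f v + k%:R * d v v), v.
  move=> _ [z _ <-]; rewrite lerBlDr (le_trans (minorant_le k u z))//.
  by rewrite -addrA lerD2l -mulrDr ler_wpM2l// addrC (dist_triangle d v).
by rewrite ler_norml lerNl opprB half andbT (dist_sym d) half.
Qed.

(** Points [y] near [x] cannot lower the infimum by more than [e], by continuity at [x]. At distance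
    at least [r] the penalty [k d x y] outweighs the oscillation [2 * C] once [k] is large. *)
Lemma lipschitz_minorant_cvg x : continuous (f : mspace d -> R) ->
  lipschitz_minorant k x @[k --> \oo] --> f x.
Proof.
move=> /(_ x)/cvgrPdist_le fx; apply/cvgrPdist_le => e e0.
have /nbhs_ballP[r /= r0 rx] := fx e e0.
have [N Nr] : exists N : nat, 2 * C <= N%:R * r.
  exists (Num.truncn (2 * C / r)).+1; rewrite -ler_pdivrMr//.
  exact/ltW/truncnS_gt.
exists N => // k /= Nk; rewrite ger0_norm ?subr_ge0 ?lipschitz_minorant_le//.
rewrite lerBlDr -lerBlDl; apply: lb_le_inf.
  by exists (f x + k%:R * d x x), x.
move=> _ [y _ <-]; have [yr|ry] := ltP (d x y) r.
  have := rx y; rewrite ballEmdist => /(_ yr) /=; rewrite ler_norml => /andP[_ fxy].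
  have : 0 <= k%:R * d x y by rewrite mulr_ge0// metric_on_ge0.
  lra.
have kd : N%:R * r <= k%:R * d x y by rewrite ler_pM// ?ler_nat// ltW.
have := f_bounded x; have := f_bounded y; rewrite !ler_norml.
by move=> /andP[fy1 fy2] /andP[fx1 fx2]; lra.
Qed.

End lipschitz_minorants.

(** The index type may be uncountable, so the union is reindexed by the countable subtype of [D]. *)
Lemma countable_bigcup_in_measurable d (T : sigmaRingType d) U (D : set U)
    (F : U -> set T) : countable D -> (forall i, measurable (F i)) ->
  measurable (\bigcup_(i in D) F i).
Proof.
move=> cD mF; rewrite (_ : \bigcup_(i in D) F i = \bigcup_(i : set_type D) F (val i)).
  apply: countable_bigcupT_measurable => //.
  have /countable_injP[g gD] := cD.
  apply/countable_injP; exists (g \o val) => i j _ _ /= /gD ij.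
  by apply/val_inj/ij; exact: valP.
apply/seteqP; split=> z [i]; first by move=> Di Fz; exists (SigSub (mem_set Di)).
by move=> _ Fz; exists (val i) => //; exact: set_mem (valP i).
Qed.

(** * Measurability of the second metric and asymptotic couplings *)

Section continuous_metric.
Context (R : realType) (E : completeMetricType R) (d : metric_on R E).
Hypothesis d_continuous : continuous (fun z : E * E => d z.1 z.2).

Lemma continuous_borel (g : E -> R) : continuous g ->
  measurable_fun setT (g : borel E -> R).
Proof.
move=> /continuousP cg; apply: (measurability _ (RGenOInfty.measurableE R)).
move=> _ [_ [a ->] <-]; rewrite setTI; apply: sub_sigma_algebra.
by apply: cg; exact: interval_open.
Qed.

Lemma continuous_metric_on x : continuous (d x).
Proof.
move=> y; have cp : (x, z) @[z --> y] --> ((x, y) : E * E).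
  by apply: cvg_pair => //; exact: cvg_cst.
have := cvg_comp _ _ cp (@d_continuous (x, y)); exact.
Qed.

(** The Lipschitz bound is in [d] while continuity is for the topology of [E]; joint continuity of
    [d] makes [d x y] vanish as [y] tends to [x] there. *)
Lemma lipschitz_continuous (g : E -> R) (L : R) :
  (forall x y, `|g x - g y| <= L * d x y) -> continuous g.
Proof.
move=> gL x.
have cL : L * d x y @[y --> x] --> 0.
  rewrite -(mulr0 L) -(distxx d x); apply: cvgMr.
  exact: continuous_metric_on.
apply/cvgrPdist_lt => e e0.
move/cvgr0Pnorm_lt: cL => /(_ e e0); apply: filterS => y.
by apply: le_lt_trans; rewrite (le_trans (gL x y))// ler_norm.
Qed.

(** For the product sigma-algebra, [d x y < r] is written as a countable union over centres [c] in a
    dense set: [d x c + d c y < r]. Such [c] form an open set containing [x]. *)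
Lemma measurable_metric_on : separable E ->
  measurable_fun setT (fun z : borel E * borel E => d z.1 z.2).
Proof.
move=> [D cD dD].
have mdl c : measurable_fun setT (fun z : borel E * borel E => d z.1 c).
  have -> : (fun z : borel E * borel E => d z.1 c) = (fun z => d c z.1).
    by apply/funext => z; exact: dist_sym.
  apply: (measurableT_comp (f := d c : borel E -> R)) => //.
  exact: continuous_borel (@continuous_metric_on c).
have mdr c : measurable_fun setT (fun z : borel E * borel E => d c z.2).
  apply: (measurableT_comp (f := d c : borel E -> R)) => //.
  exact: continuous_borel (@continuous_metric_on c).
apply: (measurability _ (RGenInftyO.measurableE R)) => _ [_ [r ->] <-].
rewrite setTI.
rewrite (_ : _ @^-1` _ = \bigcup_(c in D)
    [set z : borel E * borel E | d z.1 c + d c z.2 < r]).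
  apply: countable_bigcup_in_measurable => // c.
  apply: measurable_ltr_set => //.
  exact: (measurable_funD (mdl c) (mdr c)).
apply/seteqP; split=> -[x y] /=; rewrite in_itv/=; last first.
  by move=> [c _]; apply: le_lt_trans; exact: dist_triangle.
move=> xyr; have : open [set c | d x c + d c y < r].
  have /continuousP co : continuous (fun c => d x c + d y c).
    by move=> c; apply: cvgD; exact: continuous_metric_on.
  have := co _ (@open_lt _ r).
  rewrite (_ : _ @^-1` _ = [set c | d x c + d c y < r])//.
  by apply/seteqP; split=> c /=; rewrite (dist_sym d c y).
move=> /(dD _ _)[|c [/= cr Dc]]; last by exists c.
by exists x => /=; rewrite distxx add0r.
Qed.

Lemma measurable_dist_trajectory n : separable E ->
  measurable_fun setT
    (fun w : trajectory (borel E) * trajectory (borel E) => d (w.1 n) (w.2 n)).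
Proof.
move=> sE.
apply: (measurableT_comp (f := fun z : borel E * borel E => d z.1 z.2)
  (g := fun w : trajectory (borel E) * trajectory (borel E) => (w.1 n, w.2 n))).
  exact: measurable_metric_on.
apply/measurable_fun_pairP; split.
  exact: (measurableT_comp (measurable_coordinate n) measurable_fst).
exact: (measurableT_comp (measurable_coordinate n) measurable_snd).
Qed.

(** The difference is at most [L * eps] where the coordinates are [eps]-close and at most [2 * C]
    elsewhere, on an event of vanishing probability. *)
Lemma asymptotic_coupling_cvg
    (xi : probability (trajectory (borel E) * trajectory (borel E))%type R)
    (Z : borel E -> R) (L : R) : separable E -> 0 <= L ->
  bounded_measurable Z -> (forall x y, `|Z x - Z y| <= L * d x y) ->
  (forall eps : R, 0 < eps ->
     xi [set w | d (w.1 n) (w.2 n) <= eps] @[n --> \oo] --> 1%E) ->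
  \int[xi]_w `|Z (w.1 n) - Z (w.2 n)| @[n --> \oo] --> 0.
Proof.
move=> sE L0 bZ ZL cxi.
have [_ [C ZC]] := bZ.
have bc n : bounded_measurable (fun w : trajectory (borel E) => Z (w n)).
  exact: (bounded_measurable_comp (measurable_coordinate n)).
have bD n : bounded_measurable
    (fun w : trajectory (borel E) * trajectory (borel E) =>
      `|Z (w.1 n) - Z (w.2 n)|).
  apply: bounded_measurable_norm; apply: bounded_measurableD.
    exact: (bounded_measurable_comp measurable_fst (bc n)).
  apply: bounded_measurableN.
  exact: (bounded_measurable_comp measurable_snd (bc n)).
apply/cvgr0Pnorm_le => e e0.
(* Dividing by [L + 1] gives [L * eps <= e / 2] and also covers [L = 0]. *)
pose eps := e / 2 / (L + 1).
have eps0 : 0 < eps by rewrite !divr_gt0// ltr_wpDl.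
have Leps : L * eps <= e / 2.
  rewrite /eps mulrA ler_pdivrMr ?ltr_wpDl// mulrC ler_wpM2l ?lerDl//.
  by rewrite divr_ge0// ltW.
pose G n := [set w : trajectory (borel E) * trajectory (borel E) |
  eps < d (w.1 n) (w.2 n)].
have mG n : measurable (G n).
  by apply: measurable_ltr_set => //; exact: measurable_dist_trajectory.
have GC n : [set w | d (w.1 n) (w.2 n) <= eps] = ~` G n.
  by apply/seteqP; split=> w /=; rewrite leNgt => /negP.
have cG : fine (xi (G n)) @[n --> \oo] --> 0.
  have fG n : fine (xi (G n)) = 1 - fine (xi [set w | d (w.1 n) (w.2 n) <= eps]).
    by rewrite GC probability_setC// fineB ?fin_num_measure//= opprB addrC subrK.
  under eq_fun do rewrite fG.
  rewrite -(subrr 1); apply: cvgB; first exact: cvg_cst.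
  by have /fine_cvg := cxi _ eps0.
have iG n : bounded_measurable (\1_(G n) : _ -> R).
  split; first exact: measurable_indic.
  by exists 1 => w; rewrite indicE ger0_norm// lern1 leq_b1.
have : 2 * C * fine (xi (G n)) @[n --> \oo] --> 0.
  by rewrite -(mulr0 (2 * C)); exact: cvgMr.
have e20 : 0 < e / 2 by rewrite divr_gt0.
move=> /cvgr0Pnorm_le /(_ _ e20); apply: filterS => n Gn.
rewrite ger0_norm; last by rewrite Rintegral_ge0.
apply: (@le_trans _ _ (\int[xi]_w (L * eps + 2 * C * \1_(G n) w))).
  apply: le_Rintegral_bounded => //.
    apply: bounded_measurableD; first exact: bounded_measurable_cst.
    by apply: bounded_measurableM => //; exact: bounded_measurable_cst.
  move=> w; rewrite indicE; have [wG|wG] := boolP (w \in G n).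
    rewrite mulr1 (le_trans (ler_normB _ _))//.
    rewrite mulr_natl mulr2n -[leLHS]add0r lerD// ?lerD//.
    by rewrite mulr_ge0// ltW.
  rewrite mulr0 addr0 (le_trans (ZL _ _))// ler_wpM2l//.
  by rewrite leNgt; apply/negP => dw; move/negP: wG; apply; rewrite inE.
rewrite Rintegral_boundedD; [|exact: bounded_measurable_cst|]; last first.
  by apply: bounded_measurableM => //; exact: bounded_measurable_cst.
rewrite Rintegral_probability_cst Rintegral_boundedZ//.
rewrite [X in _ + _ * X](_ : _ = fine (xi (G n))); last first.
  by rewrite /Rintegral integral_indic// setIT.
by rewrite [leRHS]splitr lerD// (le_trans (ler_norm _)).
Qed.

End continuous_metric.

(** * Weak convergence *)

Section weak_convergence.
Context (R : realType) (E : completeMetricType R) (d : metric_on R E).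
Hypothesis E_separable : separable E.
Hypothesis d_continuous : continuous (fun z : E * E => d z.1 z.2).
Variable P : R.-pker (borel E) ~> (borel E).
Variable Pr : probability (borel E) R -> probability (trajectory (borel E)) R.
Hypothesis Pr_law : forall nu, is_chain_law P nu (Pr nu).
Variable mu : probability (borel E) R.
Hypothesis mu_invariant : invariant_measure P mu.
Hypothesis mu_mixing : mixing (Pr mu).
Variables (x : borel E) (M : set (borel E)).
Hypotheses (M_measurable : measurable M) (M_pos : (0 < mu M)%E).
Hypothesis M_coupling : forall y, M y ->
  exists xi, [/\ generalized_coupling (Pr \d_x) (Pr \d_y) xi,
    mutually_ac (pushforward xi fst) (Pr \d_x) &
    forall eps : R, 0 < eps ->
      xi [set XY | d (XY.1 n) (XY.2 n) <= eps] @[n --> \oo] --> 1%E].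

Variables (f : borel E -> R) (C : R).
Hypotheses (f_bounded : forall y, `|f y| <= C)
  (f_continuous : continuous (f : mspace d -> R)).

Let bminorant k : bounded_measurable (lipschitz_minorant d f k : borel E -> R).
Proof.
split; last by exists C => y; exact: lipschitz_minorant_bounded.
apply: continuous_borel; apply: (lipschitz_continuous d_continuous (L := k%:R)).
exact: (lipschitz_minorant_lipschitz d f_bounded k).
Qed.

(** The function is a pointwise limit of its Lipschitz minorants, which are Borel. *)
Lemma metric_continuous_bounded_measurable : bounded_measurable f.
Proof.
split; last by exists C.
apply: (@measurable_fun_cvg _ (borel E) R setT (lipschitz_minorant d f) f) => [k|y _].
  by case: (bminorant k).
exact: (lipschitz_minorant_cvg f_bounded).
Qed.

(** Half of [e] pays for replacing [f] by a minorant under [mu], by dominated convergence, and half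
    for the lower bound on the centred minorant. Under [Pr \d_x] the replacement is free, since the
    minorant lies below [f]. *)
Lemma weak_liminf (e : R) : 0 < e ->
  \forall n \near \oo, \int[mu]_y f y - e <= \int[Pr \d_x]_w f (w n).
Proof.
move=> e0; have bf := metric_continuous_bounded_measurable.
have e20 : 0 < e / 2 by rewrite divr_gt0.
have [k ek] : exists k, \int[mu]_y f y - e / 2 <= \int[mu]_y lipschitz_minorant d f k y.
  have : \int[mu]_y (lipschitz_minorant d f k y - f y) @[k --> \oo] --> 0.
    apply: (bounded_ae_cvg0_Rintegral (C := C + C)).
    - by move=> k; case: (bounded_measurableD (bminorant k) (bounded_measurableN bf)).
    - move=> k y; rewrite (le_trans (ler_normB _ _))// lerD//.
      exact: lipschitz_minorant_bounded.
    - apply: aeW => y; rewrite -(subrr (f y)); apply: cvgB; last exact: cvg_cst.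
      exact: (lipschitz_minorant_cvg f_bounded).
  move=> /cvgr0Pnorm_le /(_ _ e20) [k _ /(_ k (leqnn k))] /= ke; exists k.
  rewrite (Rintegral_boundedD _ (bminorant k) (bounded_measurableN bf)) in ke.
  by move: ke; rewrite Rintegral_boundedN// ler_norml => /andP[]; lra.
pose c := \int[mu]_y lipschitz_minorant d f k y.
pose Z (y : borel E) := lipschitz_minorant d f k y - c.
have bZ : bounded_measurable Z.
  exact: bounded_measurableD (bminorant k) (bounded_measurable_cst _ _).
have Z0 : \int[mu]_y Z y = 0.
  rewrite (Rintegral_boundedD _ (bminorant k) (bounded_measurable_cst _ _)).
  by rewrite Rintegral_probability_cst subrr.
have := generalized_coupling_liminf Pr_law mu_invariant mu_mixing
  M_measurable M_pos bZ Z0 e20.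
move=> /(_ x)[|N _ NZ].
  move=> y /M_coupling[xi [xic [_ xi1] cxi]]; exists xi; split=> //.
  apply: (asymptotic_coupling_cvg d_continuous (L := k%:R)) => // u v.
  rewrite /Z opprB addrA subrK.
  exact: (lipschitz_minorant_lipschitz d f_bounded k).
exists N => // n /NZ /=.
have bc g : bounded_measurable g ->
    bounded_measurable (fun w : trajectory (borel E) => g (w n) : R).
  exact: (bounded_measurable_comp (measurable_coordinate n)).
rewrite (Rintegral_boundedD _ (bc _ (bminorant k)) (bounded_measurable_cst _ _)).
rewrite Rintegral_probability_cst.
have : \int[Pr \d_x]_w lipschitz_minorant d f k (w n) <= \int[Pr \d_x]_w f (w n).
  apply: (le_Rintegral_bounded _ (bc _ (bminorant k)) (bc _ bf)) => w.
  exact: (lipschitz_minorant_le d f_bounded).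
by move: ek; rewrite -/c; lra.
Qed.

End weak_convergence.

Theorem theorem2p7 (R : realType)
    (E : completeMetricType R) (Esep : separable E)
    (rho_le1 : forall x y : E, mdist x y <= 1)
    (d : metric_on R E)
    (d_bounded : exists C, forall x y, d x y <= C)
    (d_continuous : continuous (fun z : E * E => d z.1 z.2))
    (Ebar : completeMetricType R) (iota : mspace d -> Ebar)
    (Ebar_completion : is_completion iota)
    (rho_approx : forall y : E, exists rho_ : nat -> Ebar -> R,
      [/\ forall n, continuous (rho_ n),
          forall n z, 0 <= rho_ n z,
          forall x : E, rho_ n (iota x) @[n --> \oo] --> mdist x y &
          forall z, ~ range iota z -> rho_ n z @[n --> \oo] --> +oo])
    (P : R.-pker (borel E) ~> (borel E))
    (Pr : probability (borel E) R -> probability (trajectory (borel E)) R)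
    (Pr_law : forall nu, is_chain_law P nu (Pr nu))
    (mu : probability (borel E) R)
    (mu_invariant : invariant_measure P mu)
    (mu_mixing : mixing (Pr mu))
    (x : borel E) (M : set (borel E))
    (M_measurable : measurable M) (M_pos : (0 < mu M)%E)
    (M_coupling : forall y, M y ->
      exists xi, [/\ generalized_coupling (Pr \d_x) (Pr \d_y) xi,
        mutually_ac (pushforward xi fst) (Pr \d_x) &
        forall eps : R, 0 < eps ->
          xi [set XY | d (XY.1 n) (XY.2 n) <= eps] @[n --> \oo] --> 1%E]) :
  weakly_converges d (fun n => nstep P n x) mu.
Proof.


move=> f f_continuous [B [_ fB]].
(* [bounded_fun] only makes numbers strictly above [B] into bounds. *)
have fC y : `|f y| <= B + 1 by apply: (fB (B + 1)); rewrite ?ltrDl.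
have bf := metric_continuous_bounded_measurable d_continuous fC f_continuous.
have law n : (\int[nstep P n x]_y (f y)%:E = \int[Pr \d_x]_w (f (w n))%:E)%E.
  apply: (integral_bounded_pushforward (measurable_coordinate n)) => // A mA.
  by rewrite (Pr_coordinate Pr_law).
have bfn n : bounded_measurable (fun w : trajectory (borel E) => f (w n)).
  exact: (bounded_measurable_comp (measurable_coordinate n)).
under eq_fun do rewrite law -EFin_Rintegral//.
rewrite -EFin_Rintegral//; apply: cvg_EFin; first exact: nearW.
apply/cvgrPdist_le => e e0.
have lo := weak_liminf Esep d_continuous Pr_law mu_invariant mu_mixing
  M_measurable M_pos M_coupling fC f_continuous e0.
have NfC y : `|- f y| <= B + 1 by rewrite normrN.
have Nf_continuous : continuous ((fun y => - f y) : mspace d -> R).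
  by move=> y; apply: continuousN; exact: f_continuous.
(* The lower bound for [- f] is the upper bound for [f]. *)
have hi := weak_liminf Esep d_continuous Pr_law mu_invariant mu_mixing
  M_measurable M_pos M_coupling NfC Nf_continuous e0.
apply: filterS2 lo hi => n /= lo; rewrite !Rintegral_boundedN// => hi.
by rewrite ler_norml; lra.
Qed.
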